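(* Let $C>0$, $\delta\in[0,1)$, $a\in(0,1]$, let $\alpha$ be an irrational number, and let $h:\mathbb{T}\to\mathbb{T}$ be Hölder continuous with exponent $a$ and $\deg(h)=0$. Suppose that $$\mu(\alpha)>1+\frac{1+a\delta}{a(1-\delta)}$$ and that the skew product $T_{\alpha,h}:\mathbb{T}^2\to\mathbb{T}^2$, $T_{\alpha,h}(x,y)=(x+\alpha,\,y+h(x))$, has $(C,\delta)$-deviation. Then $T_{\alpha,h}$ is $C^0$-rigid with polynomial decay rate.
   Context: $\mathbb{T}=\mathbb{R}/\mathbb{Z}$, $\mathbb{T}^2=\mathbb{R}^2/\mathbb{Z}^2$, $\pi:\mathbb{R}^2\to\mathbb{T}^2$ is the covering projection, $|\cdot|$ is the Euclidean norm, $\|x\|_{\mathbb{T}^m}=\min_{y\in\mathbb{Z}^m}|x-y|$, which descends to $\mathbb{T}^m$ and gives its metric $d$. $h$ is Hölder with exponent $a$ if $\|h(x)-h(y)\|_{\mathbb{T}}\le M\|x-y\|_{\mathbb{T}}^a$ for some $M<\infty$ and all $x,y$. $\deg(h)\in\mathbb{Z}$ is the degree of $h$, i.e. $h_*(1)$ for $h_*:\pi_1(\mathbb{T})\cong\mathbb{Z}\to\mathbb{Z}$. Irrationality measure: $\mu(\alpha)\in[1,\infty]$ is the supremum of all $r>0$ such that $|\alpha-p/q|<q^{-r}$ for infinitely many coprime $(p,q)\in\mathbb{Z}\times\mathbb{N}^+$. A homeomorphism $f$ of $\mathbb{T}^2$ isotopic to the identity, with lift $\tilde f$, is a pseudo-rotation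 if its rotation set $\rho(\tilde f)$ (the set of $v\in\mathbb{R}^2$ for which there are $\tilde z_i\in\mathbb{R}^2$, $n_i\to\infty$ with $(\tilde f^{n_i}(\tilde z_i)-\tilde z_i)/n_i\to v$) is a singleton; $\rho(\tilde f)$ is then identified with its unique element. When $\deg(h)=0$ and $\alpha$ is irrational, $T_{\alpha,h}$ is isotopic to the identity and is a pseudo-rotation. For a pseudo-rotation $f$, $n\ge1$, $z\in\mathbb{T}^2$ and any $\tilde z\in\pi^{-1}(z)$, put $\Delta_n(f,z)=\left|\frac{\tilde f^n(\tilde z)-\tilde z}{n}-\rho(\tilde f)\right|$ (independent of lifts), and $\Delta_N(f)=\sup_{n\ge N}\max_z\Delta_n(f,z)$. $f$ has $(C,\delta)$-deviation if $\Delta_N(f)\le CN^{\delta-1}$ for all integers $N\ge1$. $d_{C^0}(f,g)=\max_z d(f(z),g(z))$. $f$ is $C^0$-rigid with polynomial decay rate if there are $\eta>0$, a constant $C'>0$ and a strictly increasing sequence of positive integers $(n_j)$ with $d_{C^0}(f^{n_j},\mathrm{id})\le C'n_j^{-\eta}$ for all $j$. *)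

(* Defs.v *)
From HB Require Import structures.
From mathcomp Require Import all_boot all_order all_algebra.
From mathcomp Require Import generic_quotient ring_quotient.
From mathcomp Require Import all_classical all_reals all_analysis.

Set Implicit Arguments.
Unset Strict Implicit.
Unset Printing Implicit Defensive.

Import Order.TTheory GRing.Theory Num.Theory.
Import numFieldNormedType.Exports.

Local Open Scope classical_set_scope.
Local Open Scope ring_scope.
Local Open Scope quotient_scope.

(* The circle R/Z carries the quotient group structure and the quotient
   topology; the torus R^2/Z^2 is the product of two circles, with the product
   group structure and topology.  [plane] uses the regular module [R^o] so that
   [*:] is available on it; its library norm is the sup norm, hence the
   separate [eucl] below. *)
Definition integers (R : realType) : zmodClosed R :=
  GRing.ZmodClosed.clone R (@Num.int_num_subdef R) _.

Definition circle (R : realType) : Type :=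
  quotient_topology (Quotient.quot (integers R)).

HB.instance Definition _ (R : realType) := Topological.on (circle R).
HB.instance Definition _ (R : realType) :=
  GRing.Zmodule.copy (circle R) (Quotient.quot (integers R)).

Notation torus R := (circle R * circle R)%type.
Notation plane R := (R^o * R^o)%type.

Definition pr1 (R : realType) (x : R) : circle R :=
  \pi_(Quotient.quot (integers R)) x.

Definition pr2 (R : realType) (x : plane R) : torus R := (pr1 x.1, pr1 x.2).

Lemma pr1_eqP (R : realType) (x y : R) :
  pr1 x = pr1 y <-> exists m : int, x = y + m%:~R.
Proof.
have E := Quotient.idealrBE (integers R) x y.
split=> [xy|[m xym]].
  have /Num.Theory.intrP[m xym] : x - y \in integers R.
    by rewrite E; apply/eqP; exact: xy.
  by exists m; rewrite -xym addrC subrK.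
have : x - y \in integers R.
  by rewrite xym addrC addKr; exact: (Num.Theory.intr_int R m).
by rewrite E => /eqP.
Qed.

Lemma pr1_continuous (R : realType) : continuous (@pr1 R : R -> circle R).
Proof. exact: (@pi_continuous _ (Quotient.quot (integers R))). Qed.

Lemma pr1D (R : realType) : {morph @pr1 R : x y / x + y}.
Proof. exact: (raddfD \pi_(Quotient.quot (integers R))). Qed.

Definition eucl (R : realType) (x : plane R) : R :=
  Num.sqrt (x.1 ^+ 2 + x.2 ^+ 2).

Definition dist_Z (R : realType) (x : R) : R :=
  inf [set `|x - m%:~R| | m in [set: int]].

Definition dist_Z2 (R : realType) (x : plane R) : R :=
  inf [set eucl (x - (m.1%:~R, m.2%:~R)) | m in [set: int * int]].

Definition normT1 (R : realType) (x : circle R) : R :=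
  dist_Z (repr (x : Quotient.quot (integers R))).

Definition normT2 (R : realType) (z : torus R) : R :=
  dist_Z2 (repr (z.1 : Quotient.quot (integers R)),
           repr (z.2 : Quotient.quot (integers R))).

Lemma repr_pr1 (R : realType) (x : R) :
  exists m : int, repr (pr1 x : Quotient.quot (integers R)) = x + m%:~R.
Proof.
by apply/pr1_eqP; rewrite /pr1; exact: (@reprK _ (Quotient.quot (integers R))).
Qed.

Lemma normT1_pr1 (R : realType) (x : R) : normT1 (pr1 x) = dist_Z x.
Proof.
rewrite /normT1; have [k ->] := repr_pr1 x; congr inf.
apply/seteqP; split=> _ [m _ <-].
  by exists (m - k) => //; rewrite intrB opprB addrA addrAC.
by exists (m + k) => //; rewrite intrD opprD [- _ - _]addrC addrA addrK.
Qed.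

Lemma normT2_pr2 (R : realType) (x : plane R) : normT2 (pr2 x) = dist_Z2 x.
Proof.
case: x => x y; rewrite /normT2 /=.
have [k ->] := repr_pr1 x; have [l ->] := repr_pr1 y; congr inf.
apply/seteqP; split=> _ [[m n] _ <-] /=.
  exists (m - k, n - l) => //=; congr eucl; congr pair => /=;
  by rewrite intrB opprB addrA addrAC.
exists (m + k, n + l) => //=; congr eucl; congr pair => /=;
by rewrite intrD opprD [- _ - _]addrC addrA addrK.
Qed.

Definition hoelder_continuous (R : realType) (a : R)
    (h : circle R -> circle R) :=
  exists M : R, forall x y, normT1 (h x - h y) <= M * normT1 (x - y) `^ a.

(* Homotopy of paths [0, 1] -> X relative to the endpoints. *)
Definition path_homotopic (R : realType) (X : topologicalType) (p q : R -> X) :=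
  exists K : R -> R -> X,
    [/\ {within `[0, 1] `*` `[0, 1],
           continuous (fun st : R * R => K st.1 st.2)},
        {in `[0, 1], forall t, K 0 t = p t},
        {in `[0, 1], forall t, K 1 t = q t} &
        {in `[0, 1], forall s, K s 0 = p 0 /\ K s 1 = p 1}].

(* The generator 1 of the fundamental group of the circle is the class of the
   loop [t |-> pr1 t], and k is the class of [t |-> pr1 (k t)].  The image of 1
   under h_* is the class of [t |-> h (pr1 t)], a loop based at [h 0], where the
   fundamental group is identified with that at 0 by translation. *)
Definition circle_degree (R : realType) (h : circle R -> circle R) (k : int) :=
  path_homotopic (fun t : R => h (pr1 t)) (fun t : R => h 0 + pr1 (k%:~R * t)).

Definition irrationality_measure (R : realType) (alpha : R) : \bar R :=
  ereal_sup [set r%:E | r in [set r : R | 0 < r /\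
    infinite_set [set pq : int * nat |
      [/\ (0 < pq.2)%N, coprime `|pq.1|%N pq.2 &
          `|alpha - pq.1%:~R / pq.2%:R| < pq.2%:R `^ (- r)]]]].

Definition skew_product (R : realType) (alpha : R) (h : circle R -> circle R)
  (z : torus R) : torus R := (z.1 + pr1 alpha, z.2 + h z.1).

Definition homeomorphism (X : topologicalType) (f : X -> X) :=
  continuous f /\
  exists g : X -> X, [/\ continuous g, cancel f g & cancel g f].

Definition isotopic_to_id (R : realType) (f : torus R -> torus R) :=
  exists H : R -> torus R -> torus R,
    [/\ {within `[0, 1] `*` [set: torus R],
           continuous (fun tz : R * torus R => H tz.1 tz.2)},
        {in `[0, 1], forall t, homeomorphism (H t)},
        H 0 =1 id & H 1 =1 f].

Definition is_lift (R : realType) (f : torus R -> torus R)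
    (F : plane R -> plane R) :=
  continuous F /\ forall z, pr2 (F z) = f (pr2 z).

Definition displacement (R : realType) (F : plane R -> plane R) (n : nat)
  (z : plane R) : plane R := n%:R^-1 *: (iter n F z - z).

Definition rotation_set (R : realType) (F : plane R -> plane R)
    : set (plane R) :=
  [set v | exists z : nat -> plane R, exists n : nat -> nat,
     n i @[i --> \oo] --> \oo /\
     displacement F (n i) (z i) @[i --> \oo] --> v].

Definition pseudo_rotation (R : realType) (f : torus R -> torus R) :=
  [/\ homeomorphism f, isotopic_to_id f &
      exists F v, is_lift f F /\ rotation_set F = [set v]].

(* For a lift F of f with rotation set {rho}.  The point z ranges over the
   plane, that is, over all the lifts of all the points of the torus. *)
Definition Delta_n (R : realType) (F : plane R -> plane R) (rho : plane R)
  (n : nat) (z : plane R) : R := eucl (displacement F n z - rho).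

Definition Delta (R : realType) (F : plane R -> plane R) (rho : plane R)
    (N : nat) : \bar R :=
  ereal_sup [set ereal_sup [set (Delta_n F rho n z)%:E | z in [set: plane R]]
            | n in [set n | (N <= n)%N]].

Definition has_deviation (R : realType) (C delta : R)
    (f : torus R -> torus R) :=
  pseudo_rotation f /\
  forall F rho, is_lift f F -> rotation_set F = [set rho] ->
  forall N : nat, (0 < N)%N ->
    (Delta F rho N <= (C * N%:R `^ (delta - 1))%:E)%E.

Definition d_C0 (R : realType) (f g : torus R -> torus R) : \bar R :=
  ereal_sup [set (normT2 (f z - g z))%:E | z in [set: torus R]].

Definition rigid_poly (R : realType) (f : torus R -> torus R) :=
  exists (eta C' : R) (n : nat -> nat),
    [/\ 0 < eta, 0 < C', {homo n : i j / (i < j)%N},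
        forall j, (0 < n j)%N &
        forall j, (d_C0 (iter (n j) f) id <= (C' * (n j)%:R `^ (- eta))%:E)%E].

(* Main.v *)
Require Import Defs.
From mathcomp Require Import all_boot all_order all_algebra.
From mathcomp Require Import all_classical all_reals all_analysis.
From mathcomp Require Import ring lra.

Import Order.TTheory GRing.Theory Num.Theory.
Import numFieldNormedType.Exports.

Local Open Scope classical_set_scope.
Local Open Scope ring_scope.

Set Implicit Arguments.
Unset Strict Implicit.
Unset Printing Implicit Defensive.

(** A lift of T_(alpha,h) has the form F(x,y) = (x + b, y + H x), with b equal
to alpha up to an integer, so its n-th iterate is translation by n b on the
first coordinate and by the Birkhoff sum S_n(x) = H x + ... + H(x + (n-1) b)
on the second.  Deviation says |S_n(x) - n rho| <= C n^delta uniformly in x.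
Comparing S_n at x and x + 1, this sublinear bound makes H 1-periodic
([sublinear_deviation_periodic]), and H inherits from h
the bound |H y - H x| <= M |y - x|^a at small scales ([lift_local_hoelder]).

The heart of the proof is that S_q is nearly constant when p/q approximates b
very well.  Put t = |q b - p| <= q^(1-r).  By periodicity, moving the
starting point by j q b amounts to moving it by j t at most, so for m blocks
of length q

  m S_q(x) = S_(mq)(x) + O(m q M (m t)^a),

while S_(mq)(x) = m q rho + O((mq)^delta).  Dividing by m
([birkhoff_rational_approx]),

  |S_q(x) - q rho| <= C (mq)^delta / m + q M (m t)^a.

With m close to q^s the right side is of order
q^(delta - s(1-delta)) + q^(1 + a(s+1-r)) ([block_discrepancy_power]).  Both
exponents are negative as soon as delta/(1-delta) < s < r - 1 - 1/a, and such
an s exists by the lower bound on the irrationality measure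
([exponent_gap]).  Hence, for some eps > 0 and arbitrarily large q, the map
F^q is within O(q^(-eps)) of the translation by (0, q rho) modulo integers.

It remains to make this translation small: Dirichlet's theorem yields
l <= L, with L of order q^(eps/2), such that l q rho is within 1/L of an
integer.  The time n = l q costs a factor l in the errors and thus returns
every point within O(q^(-eps/2)), which is a negative power of n since
n = O(q^(1+eps/2)) ([simultaneous_return]). *)

(** * Distance to the integers *)

Lemma pr1B (R : realType) : {morph @pr1 R : x y / x - y}.
Proof. by move=> x y; apply: (addIr (pr1 y)); rewrite -pr1D !subrK. Qed.

Lemma pr10 (R : realType) : pr1 (0 : R) = 0.
Proof. by rewrite -[in LHS](subrr (0 : R)) pr1B subrr. Qed.

Lemma pr1_eq0P (R : realType) (x : R) : pr1 x = 0 -> exists m : int, x = m%:~R.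
Proof. by rewrite -pr10 => /pr1_eqP[m ->]; exists m; rewrite add0r. Qed.

Lemma dist_Z_le (R : realType) (x : R) (m : int) : dist_Z x <= `|x - m%:~R|.
Proof.
apply: ge_inf; last by exists m.
by exists 0 => _ [k _ <-].
Qed.

Lemma dist_Z_ge0 (R : realType) (x : R) : 0 <= dist_Z x.
Proof.
apply: lb_le_inf; first by exists `|x - 0%:~R|, 0.
by move=> _ [k _ <-].
Qed.

Lemma dist_Z2_le (R : realType) (x : plane R) (m n : int) :
  dist_Z2 x <= eucl (x - (m%:~R, n%:~R)).
Proof.
apply: ge_inf; last by exists (m, n).
by exists 0 => _ [k _ <-]; exact: sqrtr_ge0.
Qed.

Lemma eucl_le (R : realType) (x : plane R) : eucl x <= `|x.1| + `|x.2|.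
Proof.
rewrite /eucl -[leRHS]ger0_norm ?addr_ge0// -sqrtr_sqr ler_wsqrtr//.
by rewrite sqrrD !real_normK ?num_real// [leRHS]addrAC lerDl mulrn_wge0// mulr_ge0.
Qed.

Lemma le_eucl2 (R : realType) (x : plane R) : `|x.2| <= eucl x.
Proof. by rewrite /eucl -sqrtr_sqr ler_wsqrtr// lerDr sqr_ge0. Qed.

Lemma dist_Z_small (R : realType) (x : R) : `|x| <= 2^-1 -> `|x| <= dist_Z x.
Proof.
move=> x2; apply: lb_le_inf; first by exists `|x - 0%:~R|, 0.
move=> _ [m _ <-]; have [->|m0] := eqVneq m 0; first by rewrite subr0.
have m1 : 1 <= `|m%:~R : R| by rewrite norm_intr_ge1// intr_eq0.
have := ler_distD x (m%:~R : R) 0; rewrite !subr0 [`|_ - x|]distrC.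
lra.
Qed.

(** * Lifts *)

(** The passage from the circle to the line: along a segment, a continuous
function whose variation modulo 1 stays below e < 1/2 cannot reach the value
1/2, where the distance to the integers is 1/2, so its variation on the line
is bounded by e as well.  The case e = 0 says that continuous integer-valued
functions are constant; small e > 0 serves to lift the modulus of h. *)
Lemma no_jump (R : realType) (V : normedModType R) (G : V -> R) (x y : V)
    (e : R) :
  continuous G -> e < 2^-1 ->
  (forall u, 0 <= u <= 1 -> dist_Z (G (x + u *: (y - x)) - G x) <= e) ->
  `|G y - G x| <= e.
Proof.
move=> cG e2 He.
pose g (u : R) := `|G (x + u *: (y - x)) - G x|.
have g0 : g 0 = 0 by rewrite /g scale0r addr0 subrr normr0.
have xy : x + (y - x) = y by rewrite addrC subrK.
have g1 : g 1 = `|G y - G x| by rewrite /g scale1r xy.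
have D1 : dist_Z (G y - G x) <= e.
  by have := He 1; rewrite scale1r xy; apply; rewrite ler01 lexx.
have [le2|gt2] := leP `|G y - G x| 2^-1.
  exact: le_trans (dist_Z_small le2) D1.
have cg : continuous g.
  move=> u; apply: (@continuous_comp R R R (fun u => G (x + u *: (y - x)) - G x)).
    apply: (@continuousB R R^o); last exact: cst_continuous.
    apply: (@continuous_comp R V R (fun u => x + u *: (y - x)) G); last exact: cG.
    apply: continuousD; first exact: cst_continuous.
    exact: scalel_continuous.
  exact: norm_continuous.
have [|u] := @IVT R g 0 1 2^-1 ler01 (continuous_subspaceT cg).
  rewrite g0 g1 minEle maxEle !normr_ge0; apply/andP; split; lra.
rewrite in_itv/= => u01 gu.
have := @dist_Z_small R (G (x + u *: (y - x)) - G x).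
rewrite -/(g u) gu lexx => /(_ isT).
have := He u u01; lra.
Qed.

Lemma integral_variation (R : realType) (V : normedModType R) (G : V -> R)
    (x y : V) :
  continuous G -> (forall z, exists m : int, G z - G x = m%:~R) -> G y = G x.
Proof.
move=> cG iG; apply/eqP; rewrite -subr_eq0 -normr_le0.
apply: no_jump => // u _; have [m ->] := iG (x + u *: (y - x)).
by apply: le_trans (dist_Z_le _ m) _; rewrite subrr normr0.
Qed.

(** The smallness condition is what keeps the variation of H below 1/2, where
it agrees with the distance measured on the circle. *)
Lemma lift_local_hoelder (R : realType) (a M : R) (h : circle R -> circle R)
    (H : R -> R) :
  0 < a -> 0 <= M ->
  (forall x y, normT1 (h x - h y) <= M * normT1 (x - y) `^ a) ->
  continuous H -> (forall x, pr1 (H x) = h (pr1 x)) ->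
  forall x y, M * `|y - x| `^ a < 2^-1 ->
  `|H y - H x| <= M * `|y - x| `^ a.
Proof.
move=> a0 M0 hM cH Hh x y small.
apply: (@no_jump R R^o H x y) => // u /andP[u0 u1].
rewrite -normT1_pr1 pr1B !Hh; apply: le_trans (hM _ _) _.
rewrite ler_wpM2l// -pr1B normT1_pr1 addrAC subrr add0r.
apply: ge0_ler_powR; rewrite ?nnegrE ?dist_Z_ge0 ?(ltW a0)//.
apply: le_trans (dist_Z_le _ 0) _; rewrite subr0 normrM ger0_norm//.
by rewrite ler_piMl.
Qed.

(** Modulo integers, F(x,y) - (x,y) is alpha in the first coordinate and h(x) in
the second.  Hence the former, and the difference of the latter with its
value at (x,0), are continuous with integer variation, so constant. *)
Lemma skew_product_lift (R : realType) (alpha : R) (h : circle R -> circle R)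
    (F : plane R -> plane R) :
  is_lift (skew_product alpha h) F ->
  exists (k : int) (H : R -> R),
    [/\ continuous H, forall x, pr1 (H x) = h (pr1 x) &
        forall x y, F (x, y) = (x + (alpha + k%:~R), y + H x)].
Proof.
move=> [cF liftF].
have L1 x y : pr1 (F (x, y)).1 = pr1 x + pr1 alpha.
  by have /(congr1 fst) := liftF (x, y).
have L2 x y : pr1 (F (x, y)).2 = pr1 y + h (pr1 x).
  by have /(congr1 snd) := liftF (x, y).
pose H (x : R) := (F (x, 0)).2.
have c1 : continuous (fun z => (F z).1 : R).
  by move=> z; apply: (continuous_comp (cF z)); exact: cvg_fst.
have c2 : continuous (fun z => (F z).2 : R).
  by move=> z; apply: (continuous_comp (cF z)); exact: cvg_snd.
have cH : continuous H.
  move=> x.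
  apply: (@continuous_comp R (plane R) R (fun x => (x, 0)) (fun z => (F z).2)).
    by apply: (@cvg_pair _ _ _ _ (nbhs (x : R^o)) (nbhs (0 : R^o)));
      [exact: cvg_id|exact: cvg_cst].
  exact: c2.
have [k Hk] : exists k : int, (F 0).1 - alpha = k%:~R.
  apply: pr1_eq0P; rewrite pr1B (_ : (0 : plane R) = (0, 0))// L1.
  by rewrite pr10 add0r subrr.
exists k, H; split=> // [x|x y].
  by rewrite /H L2 pr10 add0r.
pose G1 (z : plane R) : R := (F z).1 - z.1.
pose G2 (z : plane R) : R := (F z).2 - z.2 - H z.1.
have cf : continuous (fun z : plane R => z.1 : R) by move=> z; exact: cvg_fst.
have cs : continuous (fun z : plane R => z.2 : R) by move=> z; exact: cvg_snd.
have E1 : G1 (x, y) = G1 0.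
  apply: integral_variation => [z|[u v]].
    by apply: (@continuousB R R^o _ (fun z => (F z).1) (fun z => z.1));
      [exact: c1|exact: cf].
  apply: pr1_eq0P; rewrite /G1 !pr1B L1 (_ : (0 : plane R) = (0, 0))// L1/=.
  by rewrite pr10 add0r subr0 [pr1 u + _]addrC addrK subrr.
have E2 : G2 (x, y) = G2 0.
  apply: integral_variation => [z|[u v]].
    apply: (@continuousB R R^o _ (fun z => (F z).2 - z.2) (fun z => H z.1)).
      by apply: (@continuousB R R^o _ (fun z => (F z).2) (fun z => z.2));
        [exact: c2|exact: cs].
    by apply: (continuous_comp (cf z)); exact: cH.
  apply: pr1_eq0P; rewrite /G2 /H !pr1B (_ : (0 : plane R) = (0, 0))// !L2/=.
  by rewrite !pr10 !add0r subr0 subrr subr0 [pr1 v + _]addrC addrK subrr.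
move: E1 E2; rewrite /G1 /G2 /= subr0.
rewrite (_ : (0 : plane R) = (0, 0))// in Hk *.
rewrite /= subr0 subrr => E1 /eqP; rewrite subr_eq0 => /eqP E2.
rewrite [LHS]surjective_pairing; congr pair.
  by rewrite -Hk [alpha + _]addrC subrK -E1 addrC subrK.
by rewrite -E2 addrC subrK.
Qed.

Lemma pr2_surj (R : realType) (z : torus R) : exists w : plane R, pr2 w = z.
Proof.
case: z => x y.
exists (repr (x : Quotient.quot (integers R)), repr (y : Quotient.quot (integers R))).
by congr pair; rewrite /pr1; exact: (@reprK _ (Quotient.quot (integers R))).
Qed.

(** The uniform distance is computed upstairs: the displacement of the lift has
to be close to an integer vector, which may depend on the point. *)
Lemma d_C0_lift (R : realType) (f : torus R -> torus R)
    (F : plane R -> plane R) (n : nat) (e : R) :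
  is_lift f F ->
  (forall w, exists m1 m2 : int,
     eucl (iter n F w - w - (m1%:~R, m2%:~R)) <= e) ->
  (d_C0 (iter n f) id <= e%:E)%E.
Proof.
move=> [_ lift] near_int; apply: ge_ereal_sup => _ [z _ <-].
have [w <-] := pr2_surj z.
have -> : iter n f (pr2 w) = pr2 (iter n F w).
  by elim: n {near_int} => //= n ->; rewrite lift.
have -> : pr2 (iter n F w) - pr2 w = pr2 (iter n F w - w).
  by rewrite /pr2 !pr1B.
rewrite normT2_pr2 lee_fin; have [m1 [m2 le_e]] := near_int w.
exact: le_trans (dist_Z2_le _ _ _) le_e.
Qed.

(** * Real powers *)

Lemma powR_gt0D (R : realType) (x r s : R) : 0 < x ->
  x `^ (r + s) = x `^ r * x `^ s.
Proof. by move=> x0; rewrite powRD// (gt_eqF x0) implybT. Qed.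

Lemma powR_unbounded (R : realType) (e A : R) : 0 < e ->
  exists2 n : nat, (0 < n)%N & A < n%:R `^ e.
Proof.
move=> e0; exists (Num.truncn (`|A| `^ e^-1)).+1 => //.
have := truncnS_gt (`|A| `^ e^-1).
move=> /(gt0_ltr_powR e0); rewrite !nnegrE powR_ge0 ler0n => /(_ isT isT).
rewrite -powRrM mulVf ?gt_eqF// powRr1//; apply: le_lt_trans; exact: ler_norm.
Qed.

(** Used to replace a real power of q by an integer of the same order. *)
Lemma truncnS_bounds (R : realType) (x : R) : 1 <= x ->
  x <= (Num.truncn x).+1%:R <= 2 * x.
Proof.
move=> x1; have /andP[] := @truncn_itv R x ltac:(lra).
by rewrite -natr1 => *; apply/andP; split; lra.
Qed.

(** * Diophantine approximation *)

(** Dirichlet's theorem, by pigeonhole: among the L + 1 fractional parts of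
j t, two fall in the same interval [i/L, (i+1)/L). *)
Lemma dirichlet (R : realType) (t : R) (L : nat) : (0 < L)%N ->
  exists (l : nat) (P : int), [/\ (0 < l)%N, (l <= L)%N &
    `|l%:R * t - P%:~R| <= L%:R^-1].
Proof.
move=> L0; have LR : 0 < L%:R :> R by rewrite ltr0n.
pose fr (j : nat) : R := j%:R * t - (Num.floor (j%:R * t))%:~R.
have fr_itv j : 0 <= fr j < 1.
  by have := floor_itv (j%:R * t); rewrite /fr intrD; lra.
pose bin (j : nat) := Num.truncn (L%:R * fr j).
have frL j : 0 <= L%:R * fr j by rewrite mulr_ge0 ?ler0n//; case/andP: (fr_itv j).
have binP j : (bin j)%:R <= L%:R * fr j < (bin j)%:R + 1.
  by rewrite natr1; exact: truncn_itv.
have : ~ {in `I_L.+1 &, injective bin}.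
  move=> inj; have := pigeonhole inj (n := L).
  suff : [set bin x | x in `I_L.+1] `<=` `I_L by move=> X /(_ X); rewrite ltnn.
  move=> _ [j _ <-] /=; rewrite truncn_lt_nat//.
  by rewrite gtr_pMr//; case/andP: (fr_itv j).
have key i j : (i < j)%N -> (j <= L)%N -> bin i = bin j ->
    exists (l : nat) (P : int), [/\ (0 < l)%N, (l <= L)%N &
    `|l%:R * t - P%:~R| <= L%:R^-1].
  move=> ij jL Eij.
  exists (j - i)%N, (Num.floor (j%:R * t) - Num.floor (i%:R * t)).
  split; rewrite ?subn_gt0// ?(leq_trans (leq_subr _ _))//.
  have -> : (j - i)%:R * t - (Num.floor (j%:R * t) - Num.floor (i%:R * t))%:~R
      = fr j - fr i by rewrite natrB 1?ltnW// intrB /fr; ring.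
  rewrite -div1r ler_pdivlMr// -[L%:R]normr_nat -normrM mulrC mulrBr.
  have := binP i; have := binP j; rewrite Eij => bi bj.
  by rewrite ler_norml; apply/andP; split; lra.
move=> ninj; apply: contrapT => none; apply: ninj => i j.
rewrite !inE /= !ltnS => iL jL Eij.
case: (ltngtP i j) => // ij; case: none.
  exact: key ij jL Eij.
by apply: key ij iL _; rewrite Eij.
Qed.

(** For bounded q, the inequality confines p to a bounded range, so infinitely
many solutions must involve arbitrarily large q. *)
Lemma large_denominators (R : realType) (alpha r : R) : 0 < r ->
  infinite_set [set pq : int * nat |
      [/\ (0 < pq.2)%N, coprime `|pq.1|%N pq.2 &
          `|alpha - pq.1%:~R / pq.2%:R| < pq.2%:R `^ (- r)]] ->
  forall K : nat, exists (p : int) (q : nat), [/\ (0 < q)%N, (K <= q)%N &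
    `|alpha - p%:~R / q%:R| < q%:R `^ (- r)].
Proof.
move=> r0 inf K; apply: contrapT => none; apply: inf.
pose B := Num.truncn ((`|alpha| + 1) * K%:R).
apply: (@sub_finite_set _ _
  [set ((-1) ^+ (nat_of_bool s.1) * (s.2.1)%:Z, s.2.2) |
     s in [set: bool] `*` (`I_B.+1 `*` `I_K)]).
  move=> [p q] [/= q0 _ close].
  have qK : (q < K)%N.
    by rewrite ltnNge; apply/negP => Kq; apply: none; exists p, q.
  have qR : 0 < q%:R :> R by rewrite ltr0n.
  have pq1 : `|alpha - p%:~R / q%:R| <= 1.
    apply: le_trans (ltW close) _; rewrite -[leRHS](powRr0 q%:R).
    by apply: ler_powR; [rewrite ler1n|rewrite oppr_le0 ltW].
  have pB : `|p%:~R : R| <= (`|alpha| + 1) * K%:R.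
    have : `|p%:~R / q%:R : R| <= `|alpha| + 1.
      have := ler_distD alpha (p%:~R / q%:R : R) 0; rewrite !subr0.
      by rewrite [`|_ - alpha|]distrC; lra.
    rewrite normrM normfV normr_nat ler_pdivrMr// => /le_trans; apply.
    by rewrite ler_wpM2l ?addr_ge0// ler_nat ltnW.
  exists (p < 0, (`|p|%N, q)); last by rewrite /= -intEsign.
  split=> //=; split=> //=; rewrite ltnS /B truncn_ge_nat.
    by rewrite natr_absz intr_norm.
  by rewrite mulr_ge0// addr_ge0.
apply: finite_image; apply: finite_setX; first exact: finite_finset.
by apply: finite_setX; exact: finite_II.
Qed.

(** * Birkhoff sums over a rotation *)

Definition birkhoff (R : realType) (H : R -> R) (b : R) (n : nat) (x : R) : R :=
  \sum_(i < n) H (x + i%:R * b).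

Lemma birkhoffD (R : realType) (H : R -> R) (b : R) (m n : nat) (x : R) :
  birkhoff H b (m + n) x = birkhoff H b m x + birkhoff H b n (x + m%:R * b).
Proof.
rewrite /birkhoff big_split_ord; congr (_ + _); apply: eq_bigr => i _ /=.
by rewrite natrD mulrDl addrA.
Qed.

Lemma birkhoff_mul (R : realType) (H : R -> R) (b : R) (m q : nat) (x : R) :
  birkhoff H b (m * q) x = \sum_(j < m) birkhoff H b q (x + (j * q)%:R * b).
Proof.
elim: m => [|m IH]; first by rewrite mul0n /birkhoff !big_ord0.
by rewrite mulSnr birkhoffD IH big_ord_recr.
Qed.

Lemma iter_skew (R : realType) (H : R -> R) (b : R)
    (F : plane R -> plane R) (n : nat) (x y : R) :
  (forall x y, F (x, y) = (x + b, y + H x)) ->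
  iter n F (x, y) = (x + n%:R * b, y + birkhoff H b n x).
Proof.
move=> FE; elim: n => [|n IH]; first by rewrite /birkhoff big_ord0 mul0r !addr0.
by rewrite iterS IH FE /birkhoff big_ord_recr/= -!addrA -natr1 mulrDl mul1r.
Qed.

Lemma deviation_birkhoff (R : realType) (C delta b : R) (H : R -> R)
    (F : plane R -> plane R) (rho : plane R) (n : nat) (x : R) :
  (forall x y, F (x, y) = (x + b, y + H x)) -> (0 < n)%N ->
  (Delta F rho n <= (C * n%:R `^ (delta - 1))%:E)%E ->
  `|birkhoff H b n x - n%:R * rho.2| <= C * n%:R `^ delta.
Proof.
move=> FE n0 dev; have nR : 0 < n%:R :> R by rewrite ltr0n.
have : Delta_n F rho n (x, 0) <= C * n%:R `^ (delta - 1).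
  rewrite -lee_fin; apply: le_trans dev; rewrite /Delta.
  apply: (@le_trans _ _
    (ereal_sup [set (Delta_n F rho n z)%:E | z in [set: plane R]])).
    by apply: ereal_sup_ubound; exists (x, 0).
  by apply: ereal_sup_ubound; exists n => //=.
move=> /(le_trans (le_eucl2 _)); rewrite /displacement (iter_skew _ _ _ FE).
rewrite /= add0r subr0 => /(ler_wpM2l (ltW nR)).
rewrite -{1}[n%:R]normr_nat -normrM mulrBr [_ *: _](mulrC _ _) mulrCA.
rewrite mulfV ?gt_eqF// mulr1 => /le_trans; apply.
have -> : n%:R `^ delta = n%:R * n%:R `^ (delta - 1).
  by rewrite -{2}[n%:R]powRr1 ?ler0n// -powR_gt0D// addrC subrK.
by rewrite mulrCA.
Qed.

(** H(x + 1) - H x is an integer constant d, the degree of the circle map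
lifted by H.  Then S_n(x + 1) - S_n(x) = n d, which a bound of order n^delta
with delta < 1 allows only for d = 0. *)
Lemma sublinear_deviation_periodic (R : realType) (C delta b r : R) (H : R -> R) :
  delta < 1 -> continuous H ->
  (forall x, exists d : int, H (x + 1) - H x = d%:~R) ->
  (forall n x, (0 < n)%N -> `|birkhoff H b n x - n%:R * r| <= C * n%:R `^ delta) ->
  forall x, H (x + 1) = H x.
Proof.
move=> d1 cH iH dev; have [d Hd] := iH 0.
have cst x : H (x + 1) - H x = d%:~R.
  rewrite -Hd; apply: (@integral_variation R R^o (fun x => H (x + 1) - H x)).
    move=> y; apply: (@continuousB R R^o); last exact: cH.
    apply: (@continuous_comp R R R (fun y => y + 1) H); last exact: cH.
    by apply: (@continuousD R R^o); [exact: cvg_id|exact: cst_continuous].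
  move=> z; have [e He] := iH z; exists (e - d).
  by rewrite intrB -Hd -He.
suff d0 : d = 0 by move=> x; apply/eqP; rewrite -subr_eq0 cst d0.
apply/eqP/negPn/negP => d0.
have D1 : 1 <= `|d%:~R : R| by rewrite norm_intr_ge1// intr_eq0.
(* Here n^(1-delta) exceeds 2 C, although |n d| <= 2 C n^delta. *)
have [n n0 big] := @powR_unbounded R (1 - delta) (2 * C) ltac:(lra).
have nR : 0 < n%:R :> R by rewrite ltr0n.
have E : birkhoff H b n 1 - birkhoff H b n 0 = n%:R * d%:~R.
  rewrite -sumrB (eq_bigr (fun=> d%:~R)) ?sumr_const ?card_ord ?mulr_natl// => i _.
  by rewrite add0r addrC -(cst (i%:R * b)) [1 + _]addrC addrC.
have B0 := dev n 0 n0; have B1 := dev n 1 n0.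
have : n%:R <= 2 * C * n%:R `^ delta.
  have : n%:R <= `|n%:R * d%:~R : R| by rewrite normrM normr_nat ler_peMr.
  rewrite -E; move: (ler_distD (n%:R * r) (birkhoff H b n 1) (birkhoff H b n 0)).
  rewrite [`|n%:R * r - _|]distrC; lra.
move: big; rewrite powR_gt0D// powRr1 ?ler0n// powRN ltr_pdivlMr ?powR_gt0//; lra.
Qed.

Lemma periodic_int (R : realType) (H : R -> R) :
  (forall x, H (x + 1) = H x) -> forall x (m : int), H (x + m%:~R) = H x.
Proof.
move=> per; have nat_per x (n : nat) : H (x + n%:R) = H x.
  by elim: n => [|n IH]; rewrite ?addr0// -natr1 addrA per.
move=> x [n|n]; first exact: nat_per.
by rewrite NegzE intrN -(nat_per _ n.+1) subrK.
Qed.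

(** S_(mq) splits into m blocks S_q started at x + j q b.  As H is 1-periodic,
these starting points may be replaced by x + j (q b - p), at distance at most
m |q b - p| from x, so that all blocks agree up to q M (m |q b - p|)^a; the
deviation of the long sum S_(mq), divided by m, is then inherited by S_q. *)
Lemma birkhoff_rational_approx (R : realType) (a C M b delta r : R)
    (H : R -> R) (m q : nat) (p : int) :
  0 < a -> 0 <= M -> (forall x, H (x + 1) = H x) ->
  (forall x y, M * `|y - x| `^ a < 2^-1 -> `|H y - H x| <= M * `|y - x| `^ a) ->
  (forall n x, (0 < n)%N -> `|birkhoff H b n x - n%:R * r| <= C * n%:R `^ delta) ->
  (0 < m)%N -> (0 < q)%N ->
  M * (m%:R * `|q%:R * b - p%:~R|) `^ a < 2^-1 ->
  forall x, `|birkhoff H b q x - q%:R * r| <=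
    C * (m * q)%:R `^ delta / m%:R +
    q%:R * (M * (m%:R * `|q%:R * b - p%:~R|) `^ a).
Proof.
move=> a0 M0 per hol dev m0 q0 small x; set e := M * _ `^ a in small *.
have mR : 0 < m%:R :> R by rewrite ltr0n.
have step j y : (j < m)%N -> `|H (y + (j * q)%:R * b) - H y| <= e.
  move=> jm; pose t := j%:R * (q%:R * b - p%:~R).
  have -> : H (y + (j * q)%:R * b) = H (y + t).
    rewrite -(periodic_int per (y + t) (j%:Z * p)); congr H.
    rewrite /t intrM natrM; ring.
  have le_e : M * `|y + t - y| `^ a <= e.
    rewrite /e ler_wpM2l// addrAC subrr add0r normrM normr_nat.
    apply: ge0_ler_powR; rewrite ?nnegrE ?mulr_ge0 ?(ltW a0)//.
    by rewrite ler_wpM2r// ler_nat ltnW.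
  by apply: le_trans (le_e); apply: hol; exact: le_lt_trans small.
have block j : (j < m)%N ->
    `|birkhoff H b q (x + (j * q)%:R * b) - birkhoff H b q x| <= q%:R * e.
  move=> jm; rewrite -sumrB; apply: le_trans (ler_norm_sum _ _ _) _.
  have -> : q%:R * e = \sum_(i < q) e by rewrite sumr_const card_ord mulr_natl.
  apply: ler_sum => i _.
  by rewrite addrAC; exact: step.
rewrite -[leLHS](mulKf (lt0r_neq0 mR)) mulrC ler_pdivrMr//.
rewrite mulrDl divfK ?lt0r_neq0//.
have -> : m%:R * `|birkhoff H b q x - q%:R * r| =
    `|(birkhoff H b (m * q) x - (m * q)%:R * r) -
      \sum_(j < m) (birkhoff H b q (x + (j * q)%:R * b) - birkhoff H b q x)|.
  rewrite sumrB -birkhoff_mul sumr_const card_ord -[birkhoff H b q x *+ m]mulr_natl natrM.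
  rewrite -{1}[m%:R]normr_nat -normrM; congr `|_|; ring.
apply: le_trans (ler_normB _ _) _; apply: lerD; first by rewrite dev// muln_gt0 m0.
apply: le_trans (ler_norm_sum _ _ _) _.
have -> : q%:R * e * m%:R = \sum_(j < m) (q%:R * e).
  by rewrite sumr_const card_ord mulr_natr.
apply: ler_sum => j _.
exact: block.
Qed.

(** * Choice of exponents and return times *)

(** [birkhoff_rational_approx] with m the integer following q^s, which lies
between q^s and 2 q^s; the factor 2 comes from 2^a <= 2. *)
Lemma block_discrepancy_power (R : realType) (a C M b delta rho r s : R)
    (H : R -> R) (q : nat) (p : int) :
  0 < a <= 1 -> 0 <= C -> 0 <= M -> delta < 1 -> 0 <= s -> (0 < q)%N ->
  (forall x, H (x + 1) = H x) ->
  (forall x y, M * `|y - x| `^ a < 2^-1 -> `|H y - H x| <= M * `|y - x| `^ a) ->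
  (forall n x, (0 < n)%N ->
    `|birkhoff H b n x - n%:R * rho| <= C * n%:R `^ delta) ->
  `|q%:R * b - p%:~R| <= q%:R `^ (1 - r) ->
  2 * M * q%:R `^ (a * (s + 1 - r)) < 2^-1 ->
  forall x, `|birkhoff H b q x - q%:R * rho| <=
    C * q%:R `^ (delta - s * (1 - delta)) +
    2 * M * q%:R `^ (1 + a * (s + 1 - r)).
Proof.
move=> /andP[a0 a1] C0 M0 d1 s0 q0 per hol dev close small x.
have Q1 : 1 <= q%:R :> R by rewrite ler1n.
have Q0 : 0 < q%:R :> R by rewrite ltr0n.
have X1 : 1 <= q%:R `^ s :> R by have := ler_powR Q1 s0; rewrite powRr0.
have /andP[mX m2X] := truncnS_bounds X1.
set m := (Num.truncn _).+1 in mX m2X.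
have m0 : (0 < m)%N by [].
have mR : 0 < m%:R :> R by rewrite ltr0n.
have hm : M * (m%:R * `|q%:R * b - p%:~R|) `^ a
    <= 2 * M * q%:R `^ (a * (s + 1 - r)).
  rewrite mulrC mulrAC; apply: ler_wpM2r => //.
  have a2 : 2 `^ a <= 2 :> R by apply: le_trans (ler_powR _ a1) _; rewrite ?powRr1 ?ler1n.
  apply: (@le_trans _ _ (2 `^ a * q%:R `^ (a * (s + 1 - r)))); last first.
    by rewrite ler_wpM2r// powR_ge0.
  rewrite [a * _]mulrC powRrM -powRM ?powR_ge0//.
  apply: ge0_ler_powR; rewrite ?nnegrE ?mulr_ge0 ?powR_ge0 ?(ltW a0) ?(ltW mR)//.
  rewrite -addrA powR_gt0D// mulrA; apply: ler_pM => //; exact: ltW.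
apply: le_trans (birkhoff_rational_approx a0 M0 per hol dev m0 q0 _ x) _.
  exact: le_lt_trans hm small.
apply: lerD.
  rewrite -mulrA ler_wpM2l// powR_gt0D// natrM powRM ?ler0n//.
  rewrite mulrAC mulrC ler_wpM2l ?powR_ge0//.
  rewrite -powR_inv1 ?ler0n// -powR_gt0D// (_ : delta + -1 = - (1 - delta)); last lra.
  rewrite -mulrN powRrM !powRN lef_pV2 ?posrE ?powR_gt0//.
  by apply: ge0_ler_powR; rewrite ?nnegrE ?powR_ge0 ?(ltW mR)//; lra.
rewrite powR_gt0D// powRr1 ?ler0n// [leRHS]mulrCA.
by rewrite ler_wpM2l ?ler0n.
Qed.

(** Dirichlet's theorem brings l q rho within q^(-eps/2) of an integer for some
l <= 2 q^(eps/2), and errors of order q^(-eps), multiplied by such an l, are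
still of order q^(-eps/2).  As n = l q <= 2 q^(1 + eps/2), the bound in terms
of n has exponent -(eps/2) / (1 + eps/2) = -eps / (2 + eps). *)
Lemma simultaneous_return (R : realType) (b rho eps D : R) (H : R -> R)
    (q : nat) (p : int) :
  0 < eps -> 0 <= D -> (0 < q)%N ->
  `|q%:R * b - p%:~R| <= q%:R `^ (- eps) ->
  (forall x, `|birkhoff H b q x - q%:R * rho| <= D * q%:R `^ (- eps)) ->
  exists (n : nat) (P1 P2 : int), (q <= n)%N /\ forall x,
    `|n%:R * b - P1%:~R| + `|birkhoff H b n x - P2%:~R| <=
      2 * (2 * D + 3) * n%:R `^ (- (eps / (2 + eps))).
Proof.
move=> e0 D0 q0 close dev.
have Q1 : 1 <= q%:R :> R by rewrite ler1n.
have Q0 : 0 < q%:R :> R by rewrite ltr0n.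
have X1 : 1 <= q%:R `^ (eps / 2) :> R.
  have : 0 <= eps / 2 by lra.
  by move=> /(ler_powR Q1); rewrite powRr0.
have /andP[LX L2X] := truncnS_bounds X1.
set L := (Num.truncn _).+1 in LX L2X.
have [l [P [l0 lL hP]]] := dirichlet (q%:R * rho) (isT : (0 < L)%N).
exists (l * q)%N, (l%:Z * p), P; split=> [|x]; first by rewrite leq_pmull.
have lR : 0 < l%:R :> R by rewrite ltr0n.
have l2X : l%:R <= 2 * q%:R `^ (eps / 2) :> R.
  by apply: le_trans L2X; rewrite ler_nat.
set Y := q%:R `^ (- (eps / 2)).
have lY : l%:R * q%:R `^ (- eps) <= 2 * Y.
  apply: (@le_trans _ _ (2 * q%:R `^ (eps / 2) * q%:R `^ (- eps))).
    by rewrite ler_wpM2r// powR_ge0.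
  by rewrite -mulrA -powR_gt0D// (_ : eps / 2 + - eps = - (eps / 2)); [|lra].
have B1 : `|(l * q)%:R * b - (l%:Z * p)%:~R| <= 2 * Y.
  rewrite natrM intrM -mulrA -mulrBr normrM normr_nat.
  by apply: le_trans lY; rewrite ler_wpM2l ?ler0n.
have B2 : `|birkhoff H b (l * q) x - l%:R * (q%:R * rho)| <= 2 * D * Y.
  have -> : birkhoff H b (l * q) x - l%:R * (q%:R * rho) =
      \sum_(j < l) (birkhoff H b q (x + (j * q)%:R * b) - q%:R * rho).
    by rewrite sumrB -birkhoff_mul sumr_const card_ord mulr_natl.
  apply: le_trans (ler_norm_sum _ _ _) _.
  apply: (@le_trans _ _ (\sum_(j < l) D * q%:R `^ (- eps))).
    by apply: ler_sum => j _; exact: dev.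
  rewrite sumr_const card_ord -[_ *+ l]mulr_natl mulrCA [2 * D]mulrC -mulrA.
  by rewrite ler_wpM2l.
have B3 : `|l%:R * (q%:R * rho) - P%:~R| <= Y.
  apply: le_trans hP _; by rewrite /Y powRN lef_pV2 ?posrE ?powR_gt0 ?ltr0n//.
have total : `|(l * q)%:R * b - (l%:Z * p)%:~R|
    + `|birkhoff H b (l * q) x - P%:~R| <= (2 * D + 3) * Y.
  have := ler_distD (l%:R * (q%:R * rho)) (birkhoff H b (l * q) x) P%:~R; lra.
apply: le_trans total _; rewrite [2 * (_ + _)]mulrC -mulrA.
apply: ler_wpM2l; first by lra.
set eta := eps / (2 + eps).
have eta01 : 0 <= eta <= 1.
  apply/andP; split; first by rewrite /eta divr_ge0//; lra.
  by rewrite /eta ler_pdivrMr; lra.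
case/andP: eta01 => eta0 eta1.
have nle : (l * q)%:R <= 2 * q%:R `^ (1 + eps / 2) :> R.
  rewrite addrC powR_gt0D// powRr1 ?ler0n// mulrA natrM.
  by rewrite ler_wpM2r ?ler0n.
have n0 : 0 < (l * q)%:R :> R by rewrite ltr0n muln_gt0 l0.
have two : 2 `^ eta <= 2 :> R by apply: le_trans (ler_powR _ eta1) _; rewrite ?powRr1 ?ler1n.
have YE : Y^-1 = q%:R `^ (1 + eps / 2) `^ eta.
  rewrite /Y powRN invrK -powRrM; congr powR; rewrite /eta; field; lra.
have Y0 : 0 < Y by rewrite powR_gt0.
rewrite [n in _ * n]powRN ler_pdivlMr ?powR_gt0// -ler_pdivlMl// mulrC.
apply: (@le_trans _ _ ((2 * q%:R `^ (1 + eps / 2)) `^ eta)).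
  apply: (ge0_ler_powR eta0) => //; first exact: ltW.
  by rewrite nnegrE mulr_ge0 ?powR_ge0.
by rewrite powRM ?powR_ge0// -YE ler_wpM2r// invr_ge0 ltW.
Qed.

(** The conditions on s amount to delta/(1-delta) < s < r - 1 - 1/a.  This
interval is non-empty because (1 + a delta) / (a (1 - delta)) equals
1/(a (1 - delta)) + delta/(1 - delta), whose first term is at least 1/a. *)
Lemma exponent_gap (R : realType) (a delta r : R) :
  0 <= delta < 1 -> 0 < a <= 1 ->
  1 + (1 + a * delta) / (a * (1 - delta)) < r ->
  exists s, [/\ 0 <= s, delta - s * (1 - delta) < 0,
    1 + a * (s + 1 - r) < 0 & s + 1 - r < 0].
Proof.
move=> /andP[d0 d1] /andP[a0 a1] hr.
pose A := a^-1; pose B := (1 - delta)^-1.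
have aA : a * A = 1 by rewrite mulfV// gt_eqF.
have dB : (1 - delta) * B = 1 by rewrite mulfV// gt_eqF// subr_gt0.
have A0 : 0 < A by rewrite invr_gt0.
have B0 : 0 < B by rewrite invr_gt0 subr_gt0.
have E : (1 + a * delta) / (a * (1 - delta)) = A * B + delta * B.
  by rewrite invfM -/A -/B mulrDl mul1r mulrACA aA mul1r.
have AB : A <= A * B by nra.
(* The midpoint of the admissible interval. *)
exists ((delta * B + (r - 1 - A)) / 2).
have gap : delta * B < r - 1 - A by lra.
have dB0 : 0 <= delta * B by rewrite mulr_ge0// ltW.
by split; nra.
Qed.

Lemma increasing_selection (P : nat -> Prop) :
  (forall K, exists2 n, (K <= n)%N & P n) ->
  exists u : nat -> nat, [/\ {homo u : i j / (i < j)%N},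
    forall j, (0 < u j)%N & forall j, P (u j)].
Proof.
move=> /(_ _)/cid2-/all_sig2[f fK fP].
pose u := fix u j := if j is i.+1 then f (u i).+1 else f 1%N.
exists u; split.
- by apply: homo_ltn => [? ? ?|i /=]; [exact: ltn_trans|exact: fK].
- by case=> [|j] /=; [exact: fK|apply: leq_ltn_trans (fK _)].
- by case=> [|j] /=; exact: fP.
Qed.

Theorem theorem3 (R : realType) (C delta a alpha : R)
    (h : circle R -> circle R) :
  0 < C -> 0 <= delta < 1 -> 0 < a <= 1 ->
  irrational alpha ->
  hoelder_continuous a h -> circle_degree h 0 ->
  ((1 + (1 + a * delta) / (a * (1 - delta)))%:E
     < irrationality_measure alpha)%E ->
  has_deviation C delta (skew_product alpha h) ->
  rigid_poly (skew_product alpha h).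
Proof.
move=> C0 d01 a01 _ [M0 hoel] _ /ereal_sup_gt[_ [r [r0 inf] <-]].
rewrite lte_fin => /(exponent_gap d01 a01)[s [s0 gap1 gap2 gap3]].
move=> [[_ _ [F [rho [liftF rotF]]]] dev].
have [k [H [cH Hh FE]]] := skew_product_lift liftF.
case/andP: (d01) => d0 d1; case/andP: (a01) => a0 a1.
pose b := alpha + k%:~R.
have devH n x : (0 < n)%N ->
    `|birkhoff H b n x - n%:R * rho.2| <= C * n%:R `^ delta.
  by move=> n0; apply: (@deviation_birkhoff R C delta b H F rho) => //; exact: dev.
have perH : forall x, H (x + 1) = H x.
  apply: sublinear_deviation_periodic d1 cH _ devH => x.
  apply: pr1_eq0P; rewrite pr1B !Hh.
  rewrite (_ : pr1 (x + 1) = pr1 x) ?subrr//.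
  by apply/pr1_eqP; exists 1.
pose M := `|M0|.
have M_ge0 : 0 <= M by exact: normr_ge0.
have hM x y : normT1 (h x - h y) <= M * normT1 (x - y) `^ a.
  apply: le_trans (hoel x y) _; rewrite ler_wpM2r ?powR_ge0//; exact: ler_norm.
have hol := lift_local_hoelder a0 M_ge0 hM cH Hh.
pose eps := Num.min (s * (1 - delta) - delta) (- (1 + a * (s + 1 - r))).
have eps0 : 0 < eps by rewrite lt_min; apply/andP; split; lra.
have eps1 : eps <= s * (1 - delta) - delta by rewrite ge_min lexx.
have eps2 : eps <= - (1 + a * (s + 1 - r)) by rewrite ge_min lexx orbT.
pose D := C + 2 * M.
pose eta := eps / (2 + eps); pose C' := 2 * (2 * D + 3).
have D0 : 0 <= D by rewrite addr_ge0 ?mulr_ge0// ltW.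
have good K : exists2 n, (K <= n)%N &
    (d_C0 (iter n (skew_product alpha h)) id <= (C' * n%:R `^ (- eta))%:E)%E.
  (* The bound q > 4 M puts the blocks in the range where H is Hoelder. *)
  pose K' := maxn K (Num.truncn (4 * M)).+1.
  have [p [q [q0 Kq close]]] := large_denominators r0 inf K'.
  have Q0 : 0 < q%:R :> R by rewrite ltr0n.
  have Q1 : 1 <= q%:R :> R by rewrite ler1n.
  have MQ : 4 * M < q%:R.
    apply: lt_le_trans (truncnS_gt _) _.
    by rewrite ler_nat (leq_trans _ Kq)// leq_maxr.
  have closeb : `|q%:R * b - (p + k * q%:Z)%:~R| <= q%:R `^ (1 - r).
    have -> : q%:R * b - (p + k * q%:Z)%:~R = q%:R * (alpha - p%:~R / q%:R).
      rewrite /b intrD intrM; field; exact: lt0r_neq0.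
    rewrite normrM normr_nat powR_gt0D// powRr1 ?ler0n//.
    by rewrite ler_wpM2l ?ler0n// ltW.
  have small : 2 * M * q%:R `^ (a * (s + 1 - r)) < 2^-1.
    have le1 : q%:R `^ (a * (s + 1 - r)) <= q%:R^-1 :> R.
      by rewrite -powR_inv1 ?ler0n// ler_powR//; lra.
    apply: (@le_lt_trans _ _ (2 * M * q%:R^-1)).
      by rewrite ler_wpM2l// mulr_ge0.
    by rewrite ltr_pdivrMr//; lra.
  have block x := block_discrepancy_power a01 (ltW C0) M_ge0 d1 s0 q0
    perH hol devH closeb small x.
  have blockD x : `|birkhoff H b q x - q%:R * rho.2| <= D * q%:R `^ (- eps).
    apply: le_trans (block x) _; rewrite /D [leRHS]mulrDl; apply: lerD.
      by rewrite ler_wpM2l ?(ltW C0)// ler_powR//; lra.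
    by rewrite ler_wpM2l ?mulr_ge0// ler_powR//; lra.
  have close_eps : `|q%:R * b - (p + k * q%:Z)%:~R| <= q%:R `^ (- eps).
    apply: le_trans closeb _; rewrite ler_powR//.
    have : 0 <= (1 - a) * (r - s - 1) by apply: mulr_ge0; lra.
    lra.
  have [n [P1 [P2 [qn ret]]]] := simultaneous_return eps0 D0 q0 close_eps blockD.
  exists n; first by apply: leq_trans qn; apply: leq_trans Kq; exact: leq_maxl.
  apply: (d_C0_lift liftF) => -[x y]; exists P1, P2.
  apply: le_trans (eucl_le _) (le_trans _ (ret x)).
  rewrite (iter_skew _ _ _ FE) /=.
  by rewrite [x + _]addrC [y + _]addrC !addrK.
have [u [u_lt u0 uP]] := increasing_selection good.
exists eta, C', u; split=> //; rewrite /eta /C'; last by lra.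
by rewrite divr_gt0//; lra.
Qed.
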